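(* In the setting described in the context, the mapping $\triangleright: B\otimes M_1\to M_1$ given by $$b\triangleright x=\lambda^{-1}E_{M_1}(bxe_2)$$ defines a left action of the weak Hopf algebra $B$ on $M_1$ (i.e. makes $M_1$ a left $B$-module algebra), characterized by $$b\triangleright ma=m\,\langle a_{(2)},b\rangle\,a_{(1)}$$ for all $m\in M$, $a\in A$, $b\in B$. In particular, $M$ is the subalgebra of invariants for this action.
   Context: Conventions. $k$ is a field; algebras are unital associative $k$-algebras; summation over repeated indices (finite sums) is understood; $C_X(Y)$ is the centralizer of $Y$ in $X$; Sweedler notation $\Delta(h)=h_{(1)}\otimes h_{(2)}$ is used. Extensions. An algebra extension $M/N$ is Frobenius if there are an $N$-$N$-bimodule map $E:M\to N$ (Frobenius homomorphism) and finite families $\{x_i\},\{y_i\}$ in $M$ (dual bases for $E$) with $E(mx_i)y_i=m=x_iE(y_im)$ for all $m\in M$. It is strongly separable of index $\lambda^{-1}$ if also $E(1)=1$ and $x_iy_i=\lambda^{-1}1$ with $0\neq\lambda\in k$. It is a Markov extension if moreover there is a trace $T:N\to k$ (Markov trace) with $T(1)=1$ such that $T_0:=T\circ E$ is a trace on $M$. It is a symmetric Markov extension if moreover $E(ux)=E(xu)$ for all $x\in M$, $u\in U:=C_M(N)$. A $k$-algebra is Kanzaki separable if it has a separability element that is symmetric (invariant under the flip). Jones tower. $M_1=M\otimes_N M$, $e_1=1\otimes 1$, elements written $me_1m'=m\otimes m'$, product $(me_1m')(ne_1n')=mE(m'n)e_1n'$, unit $x_ie_1y_i$, $M\subset M_1$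 via $m\mapsto mx_ie_1y_i$, and $E_M:M_1\to M$, $E_M(me_1m')=\lambda mm'$. $M_1/M$ is again a symmetric Markov extension of index $\lambda^{-1}$ with Frobenius homomorphism $E_M$ and Markov trace $T_0$. Iterating for $M_1/M$ gives $M_2=M_1e_2M_1$ and $E_{M_1}:M_2\to M_1$, $E_{M_1}(xe_2y)=\lambda xy$. Put $T_1=T_0\circ E_M$, $T_2=T_1\circ E_{M_1}$ (traces on $M_1$, $M_2$). Centralizers: $U=C_M(N)$, $V=C_{M_1}(M)$, $W=C_{M_2}(M_1)$, $A=C_{M_1}(N)$, $B=C_{M_2}(M)$, $C=C_{M_2}(N)$. One has $M_1=MA$. $T$ also denotes the restriction of $T_2$ to $C$. Let $\phi:U\to V$, $\phi(u)=x_iue_1y_i$ (an algebra anti-isomorphism). Standing assumptions. (i) $M/N$ is a symmetric Markov extension. (ii) Symmetric product: $x_iy_i=y_ix_i=\lambda^{-1}1$ (alternatively, instead of $y_ix_i=\lambda^{-1}1$ one may assume $T_0|_U=T_1\circ\phi$). (iii) Weak irreducibility: $U$ is a Kanzaki separable $k$-algebra and $T_0|_U$ is a non-degenerate trace. (iv) Depth $2$: $E_M$ has dual bases lying in $A$, and $E_{M_1}$ has dual bases $\{u_j\},\{v_j\}$ lying in $B$. Structure on $B$ and $A$. $f=f^{(1)}\otimes f^{(2)}$ is the unique symmetric separability element of $V$ and $w=[f^{(1)}T(f^{(2)})]^{-1}\in Z(V)$ (an invertible element of the center of $V$). The bilinear forms $\langle a,b\rangle=\lambda^{-2}T(ae_2e_1wb)$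 and $\langle a,b\rangle'=\lambda^{-2}T(be_1e_2wa)$ on $A\times B$ are non-degenerate. $B$ is a weak Hopf algebra with $\Delta(b)=b_{(1)}\otimes b_{(2)}$ defined by $\langle a_1,b_{(1)}\rangle\langle a_2,b_{(2)}\rangle=\langle a_1a_2,b\rangle$ for all $a_1,a_2\in A$; $\varepsilon(b)=\langle 1,b\rangle$; and antipode $S:B\to B$ defined by $\langle a,b\rangle=\langle a,S(b)\rangle'$ for all $a\in A$. The comultiplication $a\mapsto a_{(1)}\otimes a_{(2)}$ of $A$ is defined by $\langle a_{(1)},b\rangle\langle a_{(2)},b'\rangle=\langle a,bb'\rangle$ for all $b,b'\in B$. Module algebras. For a weak Hopf algebra $H$ (an algebra and coalgebra with multiplicative $\Delta$, antipode $S$, and the usual weakened unit/counit axioms) the target counital map is $\varepsilon_t(h)=\varepsilon(1_{(1)}h)1_{(2)}$, where $\Delta(1)=1_{(1)}\otimes1_{(2)}$. A left $H$-module algebra (equivalently, an action of $H$) is an algebra $X$ that is a left $H$-module with $h\cdot(xy)=(h_{(1)}\cdot x)(h_{(2)}\cdot y)$ and $h\cdot1=\varepsilon_t(h)\cdot1$. Its invariants are $X^H=\{x\in X: h\cdot x=\varepsilon_t(h)\cdot x\ \forall h\in H\}$. *)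

(* Defs.v *)
From HB Require Import structures.
From mathcomp Require Import all_boot all_order all_algebra.
From mathcomp Require Import boolp.

Set Implicit Arguments.
Unset Strict Implicit.
Unset Printing Implicit Defensive.

Import GRing.Theory.
Local Open Scope ring_scope.
Local Open Scope quotient_scope.

(* In comments, # is the tensor product. A finite sum of elementary tensors   *)
(* x1 # y1 + ... + xn # yn is encoded by the list of the pairs (xi, yi);      *)
(* [tsum f d] is the value on it of the additive map induced by a biadditive  *)
(* f.                                                                         *)
Definition tsum (X Y : Type) (P : nmodType) (f : X -> Y -> P)
  (d : seq (X * Y)) : P := \sum_(p <- d) f p.1 p.2.

Section TensorProduct.
Variables (N M : nzRingType) (iota : N -> M).

Definition balanced (P : zmodType) (f : M -> M -> P) : Prop :=
  [/\ forall x x' y, f (x + x') y = f x y + f x' y,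
      forall x y y', f x (y + y') = f x y + f x y'
    & forall x n y, f (x * iota n) y = f x (iota n * y)].

(* Two formal sums are equal in M #_N M iff no balanced map separates them.    *)
Definition tensor_rel : rel (seq (M * M)) := fun d d' =>
  `[< forall (P : zmodType) (f : M -> M -> P),
        balanced f -> tsum f d = tsum f d' >].

Lemma tensor_rel_refl : reflexive tensor_rel.
Proof. by move=> d; apply/asboolP. Qed.

Lemma tensor_rel_sym : symmetric tensor_rel.
Proof.
by move=> d d'; apply/asboolP/asboolP => h P f hf; rewrite (h P f hf).
Qed.

Lemma tensor_rel_trans : transitive tensor_rel.
Proof.
move=> d d' d'' /asboolP h1 /asboolP h2; apply/asboolP => P f hf.
by rewrite (h1 P f hf) (h2 P f hf).
Qed.

Canonical tensor_equiv :=
  EquivRel tensor_rel tensor_rel_refl tensor_rel_sym tensor_rel_trans.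

Definition tensor : Type := {eq_quot tensor_equiv}.
HB.instance Definition _ := Choice.on tensor.
HB.instance Definition _ := EqQuotient.on tensor.

Definition tens_seq (d : seq (M * M)) : tensor := \pi_tensor d.
Definition tens (x y : M) : tensor := tens_seq [:: (x, y)].

Definition tlift (P : zmodType) (f : M -> M -> P) (t : tensor) : P :=
  tsum f (repr t).

Lemma tlift_seq (P : zmodType) (f : M -> M -> P) d :
  balanced f -> tlift f (tens_seq d) = tsum f d.
Proof.
move=> hf; rewrite /tlift /tens_seq.
have /eqmodP/asboolP h : repr (\pi_tensor d) = d %[mod tensor] by rewrite reprK.
exact: h.
Qed.

Lemma tliftE (P : zmodType) (f : M -> M -> P) x y :
  balanced f -> tlift f (tens x y) = f x y.
Proof. by move=> hf; rewrite tlift_seq // /tsum big_seq1. Qed.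

Lemma tensorP (t t' : tensor) :
  (forall (P : zmodType) (f : M -> M -> P),
     balanced f -> tlift f t = tlift f t') -> t = t'.
Proof.
move=> h; rewrite -[t]reprK -[t']reprK.
by apply/eqmodP/asboolP => P f hf; apply: h.
Qed.

Definition tensor_add (t t' : tensor) : tensor := tens_seq (repr t ++ repr t').
Definition tensor_opp (t : tensor) : tensor :=
  tens_seq [seq (- p.1, p.2) | p <- repr t].

Lemma tlift_add (P : zmodType) (f : M -> M -> P) t t' :
  balanced f -> tlift f (tensor_add t t') = tlift f t + tlift f t'.
Proof. by move=> hf; rewrite tlift_seq // /tsum big_cat. Qed.

Lemma tlift_opp (P : zmodType) (f : M -> M -> P) t :
  balanced f -> tlift f (tensor_opp t) = - tlift f t.
Proof.
move=> hf; have [fD _ _] := hf.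
have fN x y : f (- x) y = - f x y.
  apply/eqP; rewrite -addr_eq0 -fD addNr; apply/eqP.
  by apply: (addrI (f 0 y)); rewrite -fD !addr0.
by rewrite tlift_seq // /tsum big_map -sumrN; apply: eq_bigr => p _ /=.
Qed.

Lemma tlift_nil (P : zmodType) (f : M -> M -> P) :
  balanced f -> tlift f (tens_seq [::]) = 0.
Proof. by move=> hf; rewrite tlift_seq // /tsum big_nil. Qed.

Lemma tensor_addA : associative tensor_add.
Proof. by move=> t u v; apply: tensorP => P f hf; rewrite !tlift_add // addrA. Qed.

Lemma tensor_addC : commutative tensor_add.
Proof. by move=> t u; apply: tensorP => P f hf; rewrite !tlift_add // addrC. Qed.

Lemma tensor_add0 : left_id (tens_seq [::]) tensor_add.
Proof.
by move=> t; apply: tensorP => P f hf; rewrite tlift_add // tlift_nil // add0r.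
Qed.

Lemma tensor_addN : left_inverse (tens_seq [::]) tensor_opp tensor_add.
Proof.
move=> t; apply: tensorP => P f hf.
by rewrite tlift_add // tlift_opp // tlift_nil // addNr.
Qed.

HB.instance Definition _ := GRing.isZmodule.Build tensor
  tensor_addA tensor_addC tensor_add0 tensor_addN.

Lemma tliftD (P : zmodType) (f : M -> M -> P) t t' :
  balanced f -> tlift f (t + t') = tlift f t + tlift f t'.
Proof. exact: tlift_add. Qed.

Lemma tlift0 (P : zmodType) (f : M -> M -> P) : balanced f -> tlift f 0 = 0.
Proof. exact: tlift_nil. Qed.

Lemma tlift_sum (P : zmodType) (f : M -> M -> P) I (r : seq I) (Q : pred I) F :
  balanced f -> tlift f (\sum_(i <- r | Q i) F i) = \sum_(i <- r | Q i) tlift f (F i).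
Proof.
move=> hf; apply: (big_morph (tlift f)); first by move=> *; apply: tliftD.
exact: tlift0.
Qed.

Lemma balanced_tens : balanced tens.
Proof.
split=> *; apply: tensorP => P f hf; have [h1 h2 h3] := hf;
  by rewrite ?tliftD // !tliftE.
Qed.

Lemma tens_seqE d : tens_seq d = \sum_(p <- d) tens p.1 p.2.
Proof.
apply: tensorP => P f hf; rewrite tlift_seq // tlift_sum //.
by apply: eq_bigr => p _; rewrite tliftE.
Qed.

Lemma tensor_ind (Q : tensor -> Prop) :
  Q 0 -> (forall t u, Q t -> Q u -> Q (t + u)) -> (forall x y, Q (tens x y)) ->
  forall t, Q t.
Proof.
move=> Q0 QD Qt t; rewrite -[t]reprK -/(tens_seq _) tens_seqE.
by apply: big_ind.
Qed.

End TensorProduct.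

(* The inclusion N <= M is an injective algebra morphism [incl]. [frob] is     *)
(* the Frobenius homomorphism E, and lam^-1 is the index.                     *)
Section Extensions.
Variables (k : fieldType) (N M : algType k).

Record strongly_separable := StronglySeparable {
  incl : {lrmorphism N -> M};
  incl_inj : injective incl;
  frob : M -> N;
  frobD : {morph frob : x y / x + y};
  frob_bimod : forall n m n', frob (incl n * m * incl n') = n * frob m * n';
  rank : nat;
  dbx : 'I_rank -> M;
  dby : 'I_rank -> M;
  dual_basis_l : forall m, \sum_i incl (frob (m * dbx i)) * dby i = m;
  dual_basis_r : forall m, \sum_i dbx i * incl (frob (dby i * m)) = m;
  frob1 : frob 1 = 1;
  lam : k;
  lam_neq0 : lam != 0;
  dual_basis_index : \sum_i dbx i * dby i = lam^-1%:A
}.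

End Extensions.

Section JonesTower.
Variables (k : fieldType) (N M : algType k) (S : strongly_separable N M).
Local Notation i := (incl S).
Local Notation E := (frob S).
Local Notation x_ := (@dbx _ _ _ S).
Local Notation y_ := (@dby _ _ _ S).
Local Notation lam := (lam S).

(* M_1 = M #_N M, where m e_1 m' is m # m'. *)
Definition jones : Type := tensor i.
HB.instance Definition _ := GRing.Zmodule.on jones.

Definition jtens (m m' : M) : jones := tens i m m'.

Lemma frobE0 : E 0 = 0.
Proof. by apply: (addrI (E 0)); rewrite -frobD !addr0. Qed.

Lemma frob_l n m : E (i n * m) = n * E m.
Proof. by rewrite -[i n * m]mulr1 -(rmorph1 i) frob_bimod mulr1. Qed.

Lemma frob_r m n : E (m * i n) = E m * n.
Proof. by rewrite -[m * i n]mul1r mulrA -(rmorph1 i) frob_bimod mul1r. Qed.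

Lemma balanced_jtens : balanced i jtens.
Proof. exact: balanced_tens. Qed.

Lemma jtensDl a b c : jtens (a + b) c = jtens a c + jtens b c.
Proof. by have [-> _ _] := balanced_jtens. Qed.
Lemma jtensDr a b c : jtens a (b + c) = jtens a b + jtens a c.
Proof. by have [_ -> _] := balanced_jtens. Qed.
Lemma jtens_bal a n b : jtens (a * i n) b = jtens a (i n * b).
Proof. by have [_ _ ->] := balanced_jtens. Qed.
Lemma jtens0l c : jtens 0 c = 0.
Proof. by apply: (addrI (jtens 0 c)); rewrite -jtensDl !addr0. Qed.
Lemma jtens0r c : jtens c 0 = 0.
Proof. by apply: (addrI (jtens c 0)); rewrite -jtensDr !addr0. Qed.
Lemma jtens_suml I (r : seq I) (Q : pred I) F c :
  jtens (\sum_(j <- r | Q j) F j) c = \sum_(j <- r | Q j) jtens (F j) c.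
Proof.
by apply: (big_morph (jtens^~ c)); [move=> *; apply: jtensDl | apply: jtens0l].
Qed.
Lemma jtens_sumr I (r : seq I) (Q : pred I) F c :
  jtens c (\sum_(j <- r | Q j) F j) = \sum_(j <- r | Q j) jtens c (F j).
Proof.
by apply: (big_morph (jtens c)); [move=> *; apply: jtensDr | apply: jtens0r].
Qed.

Lemma jones_ind (Q : jones -> Prop) :
  Q 0 -> (forall t u, Q t -> Q u -> Q (t + u)) ->
  (forall x y, Q (jtens x y)) -> forall t, Q t.
Proof. exact: tensor_ind. Qed.

Definition jones_mul (t u : jones) : jones :=
  tlift (fun a b => tlift (fun c d => jtens (a * i (E (b * c))) d) u) t.

Lemma balanced_mul_r a b :
  balanced i (fun c d => jtens (a * i (E (b * c))) d).
Proof.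
split=> [c c' d|c d d'|c n d].
- by rewrite mulrDr frobD rmorphD mulrDr jtensDl.
- exact: jtensDr.
- by rewrite mulrA frob_r rmorphM mulrA -jtens_bal.
Qed.

Lemma balanced_mul_l (u : jones) :
  balanced i (fun a b => tlift (fun c d => jtens (a * i (E (b * c))) d) u).
Proof.
have B := balanced_mul_r.
split=> [a a' b|a b b'|a n b]; elim/jones_ind: u => [|t u iht ihu|c d];
  rewrite ?tlift0 ?tliftD ?tliftE ?addr0 ?iht ?ihu 1?addrACA //.
- by rewrite mulrDl jtensDl.
- by rewrite mulrDl frobD rmorphD mulrDr jtensDl.
- by rewrite -[i n * b * c]mulrA frob_l rmorphM mulrA.
Qed.

Lemma jones_mulE a b c d :
  jones_mul (jtens a b) (jtens c d) = jtens (a * i (E (b * c))) d.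
Proof.
rewrite /jones_mul tliftE; last exact: balanced_mul_l.
by rewrite tliftE //; exact: balanced_mul_r.
Qed.

Lemma jones_mulDl : left_distributive jones_mul +%R.
Proof. by move=> t u v; rewrite /jones_mul tliftD //; apply: balanced_mul_l. Qed.

Lemma jones_mul0l t : jones_mul 0 t = 0.
Proof. by rewrite /jones_mul tlift0 //; apply: balanced_mul_l. Qed.

Lemma jones_mulDr : right_distributive jones_mul +%R.
Proof.
move=> t u v; elim/jones_ind: t => [|t t' h h'|a b].
- by rewrite !jones_mul0l addr0.
- by rewrite !jones_mulDl h h' addrACA.
- rewrite /jones_mul !tliftE; try exact: balanced_mul_l.
  by rewrite tliftD //; apply: balanced_mul_r.
Qed.

Lemma jones_mul0r t : jones_mul t 0 = 0.
Proof. by apply: (addrI (jones_mul t 0)); rewrite -jones_mulDr !addr0. Qed.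

Lemma jones_mulA : associative jones_mul.
Proof.
move=> t u v; elim/jones_ind: t => [|t t' h h'|a b].
- by rewrite !jones_mul0l.
- by rewrite !jones_mulDl h h'.
elim/jones_ind: u => [|u u' h h'|c d].
- by rewrite ?(jones_mul0l, jones_mul0r).
- by rewrite !(jones_mulDl, jones_mulDr) h h'.
elim/jones_ind: v => [|v v' h h'|e f].
- by rewrite ?(jones_mul0l, jones_mul0r).
- by rewrite !(jones_mulDl, jones_mulDr) h h'.
by rewrite !jones_mulE -!mulrA -rmorphM mulrA frob_r.
Qed.

(* x_i e_1 y_i *)
Definition jones_one : jones := \sum_j jtens (x_ j) (y_ j).

Lemma jones_mul1l : left_id jones_one jones_mul.
Proof.
move=> t; elim/jones_ind: t => [|t t' h h'|a b].
- exact: jones_mul0r.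
- by rewrite jones_mulDr h h'.
rewrite /jones_one (big_morph (jones_mul^~ _) (id1 := 0) (op1 := +%R)); first last.
- exact: jones_mul0l.
- by move=> *; apply: jones_mulDl.
under eq_bigr do rewrite jones_mulE.
by rewrite -jtens_suml dual_basis_r.
Qed.

Lemma jones_mul1r : right_id jones_one jones_mul.
Proof.
move=> t; elim/jones_ind: t => [|t t' h h'|a b].
- exact: jones_mul0l.
- by rewrite jones_mulDl h h'.
rewrite /jones_one (big_morph (jones_mul _) (id1 := 0) (op1 := +%R)); first last.
- exact: jones_mul0r.
- by move=> *; apply: jones_mulDr.
under eq_bigr do rewrite jones_mulE jtens_bal.
by rewrite -jtens_sumr dual_basis_l.
Qed.

(* E_M(m e_1 m') = lam m m' *)
Definition jones_frob (t : jones) : M := tlift (fun m m' => lam *: (m * m')) t.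

Lemma balanced_frob : balanced i (fun m m' => lam *: (m * m')).
Proof.
by split=> *; rewrite ?(mulrDl, mulrDr) ?scalerDr // mulrA.
Qed.

Lemma jones_frobE m m' : jones_frob (jtens m m') = lam *: (m * m').
Proof. by rewrite /jones_frob tliftE //; apply: balanced_frob. Qed.

Lemma jones_frobD : {morph jones_frob : x y / x + y}.
Proof. by move=> t u; rewrite /jones_frob tliftD //; apply: balanced_frob. Qed.

Lemma jones_frob0 : jones_frob 0 = 0.
Proof. by rewrite /jones_frob tlift0 //; apply: balanced_frob. Qed.

Lemma jones_frob_sum I (r : seq I) (Q : pred I) F :
  jones_frob (\sum_(j <- r | Q j) F j) = \sum_(j <- r | Q j) jones_frob (F j).
Proof. exact: (big_morph _ jones_frobD jones_frob0). Qed.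

Lemma jones_frob1 : jones_frob jones_one = 1.
Proof.
rewrite /jones_one jones_frob_sum.
under eq_bigr do rewrite jones_frobE.
by rewrite -scaler_sumr dual_basis_index scalerA mulfV ?lam_neq0 // scale1r.
Qed.

Lemma jones_one_neq0 : jones_one != 0.
Proof.
apply/eqP => h; have := jones_frob1; rewrite h jones_frob0 => /esym/eqP.
by rewrite oner_eq0.
Qed.

HB.instance Definition _ := GRing.Zmodule_isNzRing.Build jones
  jones_mulA jones_mul1l jones_mul1r jones_mulDl jones_mulDr jones_one_neq0.

Lemma jtensM a b c d : jtens a b * jtens c d = jtens (a * i (E (b * c))) d.
Proof. exact: jones_mulE. Qed.

Definition jones_scale (c : k) (t : jones) : jones :=
  tlift (fun m m' => jtens (c *: m) m') t.

Lemma balanced_scale c : balanced i (fun m m' => jtens (c *: m) m').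
Proof.
split=> *; rewrite ?scalerDr ?jtensDl ?jtensDr //.
by rewrite scalerAl jtens_bal.
Qed.

Lemma jones_scaleE c m m' : jones_scale c (jtens m m') = jtens (c *: m) m'.
Proof. by rewrite /jones_scale tliftE //; apply: balanced_scale. Qed.

Lemma jones_scaleDr c : {morph jones_scale c : t u / t + u}.
Proof. by move=> t u; rewrite /jones_scale tliftD //; apply: balanced_scale. Qed.

Lemma jones_scale0 c : jones_scale c 0 = 0.
Proof. by rewrite /jones_scale tlift0 //; apply: balanced_scale. Qed.

Lemma jones_scaleA a b t : jones_scale a (jones_scale b t) = jones_scale (a * b) t.
Proof.
elim/jones_ind: t => [|t t' h h'|x y]; first by rewrite !jones_scale0.
  by rewrite !jones_scaleDr h h'.
by rewrite !jones_scaleE scalerA.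
Qed.

Lemma jones_scale1 : left_id 1 jones_scale.
Proof.
move=> t; elim/jones_ind: t => [|t t' h h'|x y]; first by rewrite !jones_scale0.
  by rewrite !jones_scaleDr h h'.
by rewrite !jones_scaleE scale1r.
Qed.

Lemma jones_scaleDl t : {morph jones_scale^~ t : a b / a + b}.
Proof.
move=> a b; elim/jones_ind: t => [|t t' h h'|x y].
- by rewrite !jones_scale0 addr0.
- by rewrite !jones_scaleDr h h' addrACA.
- by rewrite !jones_scaleE scalerDl jtensDl.
Qed.

HB.instance Definition _ := GRing.Zmodule_isLmodule.Build k jones
  jones_scaleA jones_scale1 jones_scaleDr jones_scaleDl.

Lemma jtensZl c m m' : c *: jtens m m' = jtens (c *: m) m'.
Proof. exact: jones_scaleE. Qed.

Lemma incl_scale c : i c%:A = c%:A.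
Proof. by rewrite linearZ rmorph1. Qed.

Lemma jtensZr c m m' : c *: jtens m m' = jtens m (c *: m').
Proof.
rewrite jtensZl -[m in LHS]mulr1 scalerAr -incl_scale jtens_bal incl_scale.
by rewrite -scalerAl mul1r.
Qed.

Lemma jones_scaleAl c (t u : jones) : c *: (t * u) = (c *: t) * u.
Proof.
elim/jones_ind: t => [|t t' h h'|a b].
- by rewrite !(mul0r, scaler0).
- by rewrite scalerDr !mulrDl scalerDr h h'.
elim/jones_ind: u => [|u u' h h'|e f].
- by rewrite !(mulr0, scaler0).
- by rewrite !mulrDr scalerDr h h'.
by rewrite jtensM !jtensZl jtensM scalerAl.
Qed.

HB.instance Definition _ :=
  GRing.Lmodule_isLalgebra.Build k jones jones_scaleAl.

Lemma jones_scaleAr c (t u : jones) : c *: (t * u) = t * (c *: u).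
Proof.
elim/jones_ind: t => [|t t' h h'|a b].
- by rewrite !(mul0r, scaler0).
- by rewrite !mulrDl scalerDr h h'.
elim/jones_ind: u => [|u u' h h'|e f].
- by rewrite !(mulr0, scaler0).
- by rewrite scalerDr !mulrDr scalerDr h h'.
by rewrite jtensM !jtensZr jtensM.
Qed.

HB.instance Definition _ :=
  GRing.Lalgebra_isAlgebra.Build k jones jones_scaleAr.

(* The embedding of M in M_1, m |-> m x_i e_1 y_i *)
Definition jones_incl (m : M) : jones := \sum_j jtens (m * x_ j) (y_ j).

Lemma jones_incl_mull m a b : jones_incl m * jtens a b = jtens (m * a) b.
Proof.
rewrite /jones_incl mulr_suml.
under eq_bigr do rewrite jtensM -mulrA.
by rewrite -jtens_suml -mulr_sumr dual_basis_r.
Qed.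

Lemma jones_incl_mulr m a b : jtens a b * jones_incl m = jtens a (b * m).
Proof.
rewrite /jones_incl mulr_sumr.
under eq_bigr do rewrite jtensM mulrA jtens_bal.
by rewrite -jtens_sumr dual_basis_l.
Qed.

Fact jones_incl_linear : linear jones_incl.
Proof.
move=> c m m'; rewrite /jones_incl scaler_sumr -big_split /=.
by apply: eq_bigr => j _; rewrite mulrDl jtensDl jtensZl scalerAl.
Qed.

Fact jones_incl_monoid : monoid_morphism jones_incl.
Proof.
split=> [|m m'].
  by apply: eq_bigr => j _; rewrite mul1r.
rewrite {2}/jones_incl mulr_sumr.
by apply: eq_bigr => j _; rewrite jones_incl_mull mulrA.
Qed.

HB.instance Definition _ :=
  GRing.isLinear.Build k M jones *:%R jones_incl jones_incl_linear.
HB.instance Definition _ :=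
  GRing.isMonoidMorphism.Build M jones jones_incl jones_incl_monoid.

Lemma jones_frob_bimod m t m' :
  jones_frob (jones_incl m * t * jones_incl m') = m * jones_frob t * m'.
Proof.
elim/jones_ind: t => [|t t' h h'|a b].
- by rewrite mulr0 !mul0r jones_frob0 mulr0 mul0r.
- by rewrite mulrDr mulrDl !jones_frobD mulrDr mulrDl h h'.
rewrite jones_incl_mull jones_incl_mulr !jones_frobE.
by rewrite -scalerAr -scalerAl !mulrA.
Qed.

Lemma jones_frob_incl m : jones_frob (jones_incl m) = m.
Proof.
have := jones_frob_bimod m 1 1.
by rewrite rmorph1 !mulr1 => ->; rewrite jones_frob1 mulr1.
Qed.

Lemma jones_incl_inj : injective jones_incl.
Proof. exact: can_inj jones_frob_incl. Qed.

Definition jones_dbx (j : 'I_(rank S)) : jones := lam^-1 *: jtens (x_ j) 1.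
Definition jones_dby (j : 'I_(rank S)) : jones := jtens 1 (y_ j).

Lemma jones_dual_basis_l t :
  \sum_j jones_incl (jones_frob (t * jones_dbx j)) * jones_dby j = t.
Proof.
elim/jones_ind: t => [|t t' h h'|a b].
- by rewrite big1 // => j _; rewrite mul0r jones_frob0 raddf0 mul0r.
- rewrite -[in RHS]h -[in RHS]h' -big_split /=; apply: eq_bigr => j _.
  by rewrite mulrDl jones_frobD raddfD mulrDl.
transitivity (\sum_j jtens a (i (E (b * x_ j)) * y_ j)); last first.
  by rewrite -jtens_sumr dual_basis_l.
apply: eq_bigr => j _.
rewrite /jones_dbx -scalerAr jtensM jtensZl jones_frobE mulr1 scalerA.
by rewrite mulfV ?lam_neq0 // scale1r jones_incl_mull mulr1 jtens_bal.
Qed.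

Lemma jones_dual_basis_r t :
  \sum_j jones_dbx j * jones_incl (jones_frob (jones_dby j * t)) = t.
Proof.
elim/jones_ind: t => [|t t' h h'|a b].
- by rewrite big1 // => j _; rewrite mulr0 jones_frob0 raddf0 mulr0.
- rewrite -[in RHS]h -[in RHS]h' -big_split /=; apply: eq_bigr => j _.
  by rewrite mulrDr jones_frobD raddfD mulrDr.
transitivity (\sum_j jtens (x_ j * i (E (y_ j * a))) b); last first.
  by rewrite -jtens_suml dual_basis_r.
apply: eq_bigr => j _.
rewrite /jones_dbx /jones_dby jtensM jones_frobE mul1r.
rewrite linearZ_LR /= -scalerAl -scalerAr scalerA mulVf ?lam_neq0 // scale1r.
by rewrite jones_incl_mulr mul1r jtens_bal.
Qed.

Lemma jones_dual_basis_index :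
  \sum_j jones_dbx j * jones_dby j = lam^-1%:A.
Proof.
rewrite [1 in RHS]/(1 : jones) /= [X in _ = _ *: X]/jones_one scaler_sumr.
apply: eq_bigr => j _.
by rewrite /jones_dbx -scalerAl jtensM mulr1 frob1 rmorph1 mulr1.
Qed.

(* M_1/M is strongly separable of index lam^-1, with E_M and dual bases        *)
(* lam^-1 x_i e_1 and e_1 y_i, so that the construction can be iterated.      *)
Definition jones_ext : strongly_separable M jones :=
  @StronglySeparable k M jones jones_incl jones_incl_inj
    jones_frob jones_frobD jones_frob_bimod
    _ jones_dbx jones_dby jones_dual_basis_l jones_dual_basis_r
    jones_frob1 lam (lam_neq0 S) jones_dual_basis_index.

End JonesTower.

Section Centralizer.
Variables (k : fieldType) (X : Type) (R : algType k) (g : X -> R).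

Definition centralizes : {pred R} :=
  fun r => `[< forall x, r * g x = g x * r >].

Lemma centralizesP r : reflect (forall x, r * g x = g x * r) (r \in centralizes).
Proof. exact: asboolP. Qed.

Fact centralizes_subalg : subalg_closed centralizes.
Proof.
split.
- by apply/centralizesP => x; rewrite mul1r mulr1.
- move=> c r s /centralizesP hr /centralizesP hs; apply/centralizesP => x.
  by rewrite mulrDl mulrDr -scalerAl -scalerAr hr hs.
- move=> r s /centralizesP hr /centralizesP hs; apply/centralizesP => x.
  by rewrite -mulrA hs mulrA hr mulrA.
Qed.

(* C_R(g(X)) as a k-algebra *)
Record centralizer := Centralizer { cval : R; _ : cval \in centralizes }.

HB.instance Definition _ := [isSub for cval].
HB.instance Definition _ := [Choice of centralizer by <:].
HB.instance Definition _ :=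
  GRing.SubChoice_isSubAlgebra.Build k R _ centralizer
    (GRing.subalg_closed_semi centralizes_subalg).

End Centralizer.

Section MarkovExtensions.
Variable k : fieldType.

Definition is_trace (R : algType k) (t : R -> k) : Prop :=
  scalar t /\ forall x y, t (x * y) = t (y * x).

Record symmetric_markov (N M : algType k) (S : strongly_separable N M)
    (T : N -> k) : Prop := SymmetricMarkov {
  markov_trace : is_trace T;
  markov_trace1 : T 1 = 1;
  markov_trace_frob : is_trace (T \o frob S);
  markov_symmetric : forall u x, u \in centralizes (incl S) ->
    frob S (u * x) = frob S (x * u)
}.

Definition has_dual_bases_in (N M : algType k) (S : strongly_separable N M)
    (X : {pred M}) : Prop :=
  exists (r : nat) (u v : 'I_r -> M),
    [/\ forall j, u j \in X /\ v j \in X,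
        forall m, \sum_j incl S (frob S (m * u j)) * v j = m
      & forall m, \sum_j u j * incl S (frob S (v j * m)) = m].

End MarkovExtensions.

(* Two formal sums are equal in H # H over the field k iff every bilinear map  *)
(* agrees on them; all identities below between Sweedler sums are stated by    *)
(* evaluating them on arbitrary bilinear or trilinear maps.                    *)
Section WeakHopf.
Variables (k : fieldType) (H : algType k).

Definition bilin (V V' P : lmodType k) (f : V -> V' -> P) : Prop :=
  (forall y, linear (f^~ y)) /\ (forall x, linear (f x)).

Definition trilin (P : lmodType k) (f : H -> H -> H -> P) : Prop :=
  [/\ forall y z, linear (fun x => f x y z),
      forall x z, linear (fun y => f x y z)
    & forall x y, linear (fun z => f x y z)].

Definition symmetric_separability_element (f : seq (H * H)) : Prop :=
  [/\ tsum (fun x y => x * y) f = 1,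
      forall (h : H) (P : lmodType k) (b : H -> H -> P), bilin b ->
        tsum (fun x y => b (h * x) y) f = tsum (fun x y => b x (y * h)) f
    & forall (P : lmodType k) (b : H -> H -> P), bilin b ->
        tsum b f = tsum (fun x y => b y x) f].

Definition kanzaki_separable : Prop :=
  exists f, symmetric_separability_element f.

Record weak_hopf := WeakHopf {
  (* comul h is a list of pairs representing h_(1) # h_(2) *)
  comul : H -> seq (H * H);
  counit : H -> k;
  antipode : H -> H;
  comul_linear : forall (P : lmodType k) (b : H -> H -> P), bilin b ->
    linear (fun h => tsum b (comul h));
  counit_linear : scalar counit;
  antipode_linear : linear antipode;
  comul_coassoc : forall h (P : lmodType k) (t : H -> H -> H -> P), trilin t ->
    tsum (fun x z => tsum (fun x' y => t x' y z) (comul x)) (comul h)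
    = tsum (fun x y => tsum (t x) (comul y)) (comul h);
  counitl : forall h, tsum (fun x y => counit x *: y) (comul h) = h;
  counitr : forall h, tsum (fun x y => counit y *: x) (comul h) = h;
  comulM : forall g h (P : lmodType k) (b : H -> H -> P), bilin b ->
    tsum b (comul (g * h))
    = tsum (fun g1 g2 => tsum (fun h1 h2 => b (g1 * h1) (g2 * h2)) (comul h))
           (comul g);
  (* (Delta(1) # 1)(1 # Delta(1)) = (Delta # id) Delta(1)
       = (1 # Delta(1))(Delta(1) # 1) *)
  comul1l : forall (P : lmodType k) (t : H -> H -> H -> P), trilin t ->
    tsum (fun x y => tsum (t x) (comul y)) (comul 1)
    = tsum (fun x y => tsum (fun x' y' => t x (y * x') y') (comul 1)) (comul 1);
  comul1r : forall (P : lmodType k) (t : H -> H -> H -> P), trilin t ->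
    tsum (fun x y => tsum (t x) (comul y)) (comul 1)
    = tsum (fun x y => tsum (fun x' y' => t x (x' * y) y') (comul 1)) (comul 1);
  counitMl : forall f g h,
    counit (f * g * h)
    = tsum (fun g1 g2 => counit (f * g1) * counit (g2 * h)) (comul g);
  counitMr : forall f g h,
    counit (f * g * h)
    = tsum (fun g1 g2 => counit (f * g2) * counit (g1 * h)) (comul g);
  antipoder : forall h,
    tsum (fun h1 h2 => h1 * antipode h2) (comul h)
    = tsum (fun x y => counit (x * h) *: y) (comul 1);
  antipodel : forall h,
    tsum (fun h1 h2 => antipode h1 * h2) (comul h)
    = tsum (fun x y => counit (h * y) *: x) (comul 1);
  antipode3 : forall h,
    tsum (fun x h3 =>
        tsum (fun h1 h2 => antipode h1 * h2 * antipode h3) (comul x)) (comul h)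
    = antipode h
}.

Definition target_counit (W : weak_hopf) (h : H) : H :=
  tsum (fun x y => counit W (x * h) *: y) (comul W 1).

Variables (W : weak_hopf) (X : algType k) (act : H -> X -> X).

Record module_algebra : Prop := ModuleAlgebra {
  act_bilin : bilin act;
  act1 : forall x, act 1 x = x;
  actM : forall g h x, act (g * h) x = act g (act h x);
  act_mul : forall h x y,
    act h (x * y) = tsum (fun h1 h2 => act h1 x * act h2 y) (comul W h);
  act_one : forall h, act h 1 = act (target_counit W h) 1
}.

Definition act_invariant (x : X) : Prop :=
  forall h, act h x = act (target_counit W h) x.

End WeakHopf.

Section Setting.
Variables (k : fieldType) (N M : algType k) (S : strongly_separable N M).
Variable T : N -> k.

Definition M1 : algType k := jones S.
Definition ext1 : strongly_separable M M1 := jones_ext S.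
Definition M2 : algType k := jones ext1.
Definition ext2 : strongly_separable M1 M2 := jones_ext ext1.

Definition incl1 (m : M) : M1 := incl ext1 m.
Definition incl2 (x : M1) : M2 := incl ext2 x.
Definition e1 : M1 := jtens S 1 1.
Definition e2 : M2 := jtens ext1 1 1.
Definition EM (x : M1) : M := frob ext1 x.
Definition EM1 (x : M2) : M1 := frob ext2 x.

Definition T0 (m : M) : k := T (frob S m).
Definition T1 (x : M1) : k := T0 (EM x).
Definition T2 (x : M2) : k := T1 (EM1 x).

Definition algU : algType k := centralizer (incl S).
Definition algV : algType k := centralizer incl1.
Definition algA : algType k := centralizer (fun n => incl1 (incl S n)).
Definition algB : algType k := centralizer (fun m => incl2 (incl1 m)).

Definition phi (u : M) : M1 := \sum_j incl1 (dbx j * u) * e1 * incl1 (dby (s:=S) j).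

Definition symmetric_product : Prop :=
  \sum_j dby (s:=S) j * dbx j = (lam S)^-1%:A.

Definition T0_phi_compatible : Prop :=
  forall u : algU, T0 (\val u) = T1 (phi (\val u)).

Definition T0_nondegenerate_on_U : Prop :=
  forall u : algU, (forall u' : algU, T0 (\val u * \val u') = 0) -> u = 0.

Definition depth2 : Prop :=
  has_dual_bases_in ext1 (centralizes (fun n => incl1 (incl S n)))
  /\ has_dual_bases_in ext2 (centralizes (fun m => incl2 (incl1 m))).

(* w = (f^(1) T(f^(2)))^-1 *)
Definition is_weight (f : seq (algV * algV)) (w : algV) : Prop :=
  let s := tsum (fun x y => T2 (incl2 (\val y)) *: x) f in
  w * s = 1 /\ s * w = 1.

Definition pairing (w : algV) (a : algA) (b : algB) : k :=
  (lam S)^-2 * T2 (incl2 (\val a) * e2 * incl2 e1 * incl2 (\val w) * \val b).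

Definition pairing' (w : algV) (a : algA) (b : algB) : k :=
  (lam S)^-2 * T2 (\val b * incl2 e1 * e2 * incl2 (\val w) * incl2 (\val a)).

Definition jones_act (b : algB) (x : M1) : M1 :=
  (lam S)^-1 *: EM1 (\val b * incl2 x * e2).

End Setting.

(* Main.v *)
Require Import Defs.
From HB Require Import structures.
From mathcomp Require Import all_boot all_order all_algebra.

Set Implicit Arguments.
Unset Strict Implicit.
Unset Printing Implicit Defensive.

Import GRing.Theory.
Local Open Scope ring_scope.

(** Write [b |> x] for [jones_act b x] and [<a, b>] for the pairing of [A] with
    [B].  Everything rests on one description of the action: in [M2],
    [b |> x] is the unique element of [M1] with [(b |> x) e2 = b x e2]
    ([jones_act_e2], [jones_actP]).  It exists because every element of
    [M2 e2] is of the form [y e2] with [y] in [M1], and it is unique because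
    [E_M1 (y e2)] is a nonzero multiple of [y].  Associativity of the action is
    then immediate; and since [b] and [e2] both commute with [M], the action is
    left and right [M]-linear, hence preserves [A] and maps [1] into [V].

    The trace property of [T2] turns this description into the adjunction
    [<b |> a, b'> = <a, b' b>] ([pairing_actA]).  As the pairing is
    non-degenerate, the remaining identities in [A] may be checked against all
    [b'], where they become statements about the product and coproduct of [B]:
    [b |> (a a') = (b1 |> a) (b2 |> a')] is multiplicativity of the
    comultiplication of [B], and [b |> a = <a2, b> a1] is the definition of the
    comultiplication of [A].  Because [M1 = M A], [M]-linearity carries these
    identities to all of [M1].  Pairing on the other side shows that
    [eps_t b = b |> 1], as elements of the subalgebra [V] of [B]
    ([target_counitE]).  Therefore [b |> 1 = eps_t b |> 1], so that [M] is
    invariant, and conversely an invariant [x] satisfies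
    [E_M x = e2 |> x = eps_t e2 |> x = 1 |> x = x].

    As [w] is invertible, the pairing is non-degenerate when the form
    [T2 (a e2 e1 b)] is, and this goes up the tower.  The Markov trace is
    non-degenerate on [U] by hypothesis, hence on [V] through the
    anti-isomorphism [phi]; dual bases that lie in the centralizers pass from
    [U] to [A] and from [V] to [B] ([nondegenerate_frob]).  If [a] is in the
    left radical, averaging [c = a e2 e1] over the dual bases of [M] gives an
    element of [B] orthogonal to [B], hence zero, and the relations
    [e1 m e1 = E(m) e1] and [e2 e1 e2 = lam e2] recover from it first [c = 0],
    then [a = 0].  If [b] is in the right radical, [E_M1 (e2 e1 b)] is
    orthogonal to [A], so [e2 e1 b = 0] and then [b = 0]. *)

(** * Linear maps and centralizers *)

(** The maps of this development (traces, the pairing in each variable, the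
    action of a fixed element) are bare functions with a linearity proof; these
    lemmas give access to their additivity. *)
Section LinearMaps.
Variables (k : fieldType) (V W : lmodType k) (f : V -> W).
Hypothesis lf : linear f.
Let g : {linear V -> W} := HB.pack f (GRing.isLinear.Build k V W *:%R f lf).

Lemma linear_map0 : f 0 = 0.
Proof. exact: (linear0 g). Qed.
Lemma linear_mapD x y : f (x + y) = f x + f y.
Proof. exact: (linearD g). Qed.
Lemma linear_mapB x y : f (x - y) = f x - f y.
Proof. exact: (linearB g). Qed.
Lemma linear_mapZ c x : f (c *: x) = c *: f x.
Proof. exact: (linearZ_LR g). Qed.
Lemma linear_map_sum I (r : seq I) (P : pred I) F :
  f (\sum_(l <- r | P l) F l) = \sum_(l <- r | P l) f (F l).
Proof. exact: (linear_sum g). Qed.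
End LinearMaps.

Section Centralizers.
Variables (k : fieldType) (R : algType k).

Lemma centralizesM (X : Type) (g : X -> R) r s :
  r \in centralizes g -> s \in centralizes g -> r * s \in centralizes g.
Proof. by case: (centralizes_subalg g) => _ _; apply. Qed.

Lemma centralizesZ (X : Type) (g : X -> R) c r :
  r \in centralizes g -> c *: r \in centralizes g.
Proof.
by move=> /centralizesP hr; apply/centralizesP => x; rewrite -scalerAl hr scalerAr.
Qed.

Lemma centralizes_comp (X Y : Type) (g : X -> R) (h : Y -> X) r :
  r \in centralizes g -> r \in centralizes (fun y => g (h y)).
Proof. by move=> /centralizesP hr; apply/centralizesP => y. Qed.

Lemma centralizes_rmorph (Q : algType k) (X : Type) (g : X -> R)
    (j : {rmorphism R -> Q}) r :
  r \in centralizes g -> j r \in centralizes (fun x => j (g x)).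
Proof.
by move=> /centralizesP hr; apply/centralizesP => x; rewrite -!rmorphM hr.
Qed.

Lemma cval_sum (X : Type) (g : X -> R) I (r : seq I) (P : pred I)
    (F : I -> centralizer g) :
  cval (\sum_(l <- r | P l) F l) = \sum_(l <- r | P l) cval (F l).
Proof. exact: (big_morph (@cval _ _ _ g)). Qed.

End Centralizers.

(** * One step of the Jones tower *)

Section FrobeniusMap.
Variables (k : fieldType) (N M : algType k) (S : strongly_separable N M).
Local Notation E := (frob S).

Lemma frobZ c m : E (c *: m) = c *: E m.
Proof. by rewrite -[c *: m]mulr_algr -(incl_scale S) frob_r mulr_algr. Qed.

Lemma sum_dual_basis_frob : \sum_l dbx l * incl S (E (dby (s:=S) l)) = 1.
Proof. by rewrite -[RHS](dual_basis_r S); apply: eq_bigr => l _; rewrite mulr1. Qed.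

End FrobeniusMap.

Section TowerStep.
Variables (k : fieldType) (N M : algType k) (S : strongly_separable N M).
Local Notation i := (incl S).
Local Notation E := (frob S).
Local Notation j := (incl (jones_ext S)).
Local Notation F := (frob (jones_ext S)).
Local Notation lam := (lam S).
Local Notation e := (jtens S 1 1 : jones S).

Lemma jones_projE m m' : j m * e * j m' = jtens S m m'.
Proof. by rewrite /= jones_incl_mull jones_incl_mulr mulr1 mul1r. Qed.

Lemma jones_proj_comm n : e * j (i n) = j (i n) * e.
Proof.
rewrite /= jones_incl_mull jones_incl_mulr mul1r mulr1.
by rewrite -[in LHS](mulr1 (i n)) -jtens_bal mul1r.
Qed.

Lemma jones_proj_frob m : e * j m * e = j (i (E m)) * e.
Proof. by rewrite /= jones_incl_mulr jtensM jones_incl_mull !mulr1 !mul1r. Qed.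

Lemma frob_jones_proj m : F (j m * e) = lam *: m.
Proof. by rewrite /= jones_incl_mull jones_frobE !mulr1. Qed.

Lemma jones_proj_inj m m' : j m * e = j m' * e -> m = m'.
Proof.
move=> h; have := congr1 F h; rewrite !frob_jones_proj.
exact: (scalerI (lam_neq0 S)).
Qed.

(** [M1 e = M e]: since [(a e b) e = a E(b) e], an element [t e] is determined
    by its image under the conditional expectation. *)
Lemma absorb_jones_proj_r t : j (lam^-1 *: F (t * e)) * e = t * e.
Proof.
elim/jones_ind: t => [|t u ht hu|a b].
- by rewrite mul0r frobE0 scaler0 raddf0 mul0r.
- by rewrite !mulrDl frobD scalerDr raddfD mulrDl ht hu.
rewrite jtensM mulr1 [F _]jones_frobE mulr1 scalerA mulVf ?lam_neq0 // scale1r.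
by rewrite /= jones_incl_mull mulr1.
Qed.

Lemma absorb_jones_proj_l t : e * j (lam^-1 *: F (e * t)) = e * t.
Proof.
elim/jones_ind: t => [|t u ht hu|a b].
- by rewrite mulr0 frobE0 scaler0 raddf0 mulr0.
- by rewrite !mulrDr frobD scalerDr raddfD mulrDr ht hu.
rewrite jtensM mul1r [F _]jones_frobE scalerA mulVf ?lam_neq0 // scale1r.
by rewrite /= jones_incl_mulr mul1r -[in RHS](mul1r (i _)) jtens_bal mul1r.
Qed.

Lemma sum_jones_proj : \sum_l j (dbx l) * e * j (dby (s:=S) l) = 1.
Proof. by apply: eq_bigr => l _; rewrite jones_projE. Qed.

(** On elementary tensors the trace of [(a e b) (c e d)] is
    [lam T(E(b c) E(d a))], which the trace property of [T] makes symmetric. *)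
Lemma trace_tower (T : N -> k) :
  is_trace T -> is_trace (T \o E) -> is_trace (T \o E \o F).
Proof.
move=> [Tl Tc] [TEl TEc]; split=> [c t u|].
  by rewrite /comp !(frobD, frobZ) Tl.
move=> t u; rewrite /comp.
have TD := linear_mapD (W := k^o) Tl.
have TZ := linear_mapZ (W := k^o) Tl.
elim/jones_ind: t => [|t t' h h'|a b]; first by rewrite mulr0 mul0r.
  by rewrite mulrDl mulrDr !frobD !TD h h'.
elim/jones_ind: u => [|u u' h h'|c d]; first by rewrite mulr0 mul0r.
  by rewrite mulrDl mulrDr !frobD !TD h h'.
rewrite !jtensM ![F _]jones_frobE !frobZ !TZ.
have := TEc (a * i (E (b * c))) d; rewrite /= => ->.
have := TEc (c * i (E (d * a))) b; rewrite /= => ->.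
by rewrite !mulrA !frob_r Tc.
Qed.

End TowerStep.

(** * Relations between the two Jones projections *)

Section Tower.
Variables (k : fieldType) (N M : algType k) (S : strongly_separable N M).

Lemma e1_A : e1 S \in centralizes (fun n => incl1 S (incl S n)).
Proof. by apply/centralizesP => n; rewrite /e1 /incl1 jones_proj_comm. Qed.

Lemma incl2M (x y : M1 S) : incl2 (x * y) = incl2 x * incl2 y.
Proof. exact: rmorphM. Qed.

Lemma incl2_1 : incl2 (1 : M1 S) = 1.
Proof. exact: rmorph1. Qed.

Lemma incl2_e2 m : incl2 (incl1 S m) * e2 S = e2 S * incl2 (incl1 S m).
Proof. by rewrite /e2 /incl2 jones_proj_comm. Qed.

Lemma e2_B : e2 S \in centralizes (fun m => incl2 (incl1 S m)).
Proof. by apply/centralizesP => m; rewrite incl2_e2. Qed.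

Lemma e2_e1_e2 : e2 S * incl2 (e1 S) * e2 S = lam S *: e2 S.
Proof.
rewrite /e2 /incl2 jones_proj_frob -[e1 S]mul1r -(rmorph1 (incl (ext1 S))).
by rewrite frob_jones_proj !linearZ /= !rmorph1 -scalerAl mul1r.
Qed.

Lemma dby_ext1 (l : 'I_(rank S)) :
  dby (s:=ext1 S) l = e1 S * incl1 S (dby (s:=S) l).
Proof. by rewrite /e1 /incl1 /= jones_incl_mulr mul1r. Qed.

(** The dual bases [lam^-1 x_l e1] and [e1 y_l] of [M1] over [M] write [1] as
    a sum of terms [lam^-1 x_l e1 e2 e1 y_l]; as [b] commutes with [y_l], it is
    the sum of the [lam^-1 x_l e1 (e2 e1 b) y_l]. *)
Lemma e2_e1_cancel b :
  b \in centralizes (fun m => incl2 (incl1 S m)) ->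
  e2 S * incl2 (e1 S) * b = 0 -> b = 0.
Proof.
move=> /centralizesP hb h; rewrite -[b]mul1r -(sum_jones_proj (ext1 S)) mulr_suml.
apply: big1 => l _.
rewrite (dby_ext1 l) rmorphM -!mulrA -/(incl2 _) -/(incl2 _) -hb.
by rewrite [_ * (b * _)]mulrA [e2 S * _]mulrA [e2 S * _]mulrA h mul0r mulr0.
Qed.

End Tower.

(** * Non-degeneracy along Frobenius extensions *)

Definition nondegenerate_on (k : fieldType) (R : algType k) (t : R -> k)
    (D : {pred R}) : Prop :=
  forall x, x \in D -> (forall y, y \in D -> t (x * y) = 0) -> x = 0.

Section Casimir.
Variables (k : fieldType) (N M : algType k) (S : strongly_separable N M).

Lemma frob_centralizes (X : Type) (g : X -> N) m :
  m \in centralizes (fun x => incl S (g x)) -> frob S m \in centralizes g.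
Proof.
by move=> /centralizesP hm; apply/centralizesP => x; rewrite -frob_r hm frob_l.
Qed.

(** The coordinates of [x] in dual bases that centralize [g] lie in the
    centralizer of [g] in [N], and are orthogonal to it as soon as [x] is
    orthogonal to the centralizer in [M]. *)
Lemma nondegenerate_frob (X : Type) (g : X -> N) (t : N -> k) :
  has_dual_bases_in S (centralizes (fun x => incl S (g x))) ->
  nondegenerate_on t (centralizes g) ->
  nondegenerate_on (t \o frob S) (centralizes (fun x => incl S (g x))).
Proof.
move=> [r [u [v [uv hl _]]]] ndt x hx h.
rewrite -(hl x) big1 // => j _; have [hu _] := uv j.
rewrite [frob _ _]ndt ?raddf0 ?mul0r //.
  by apply: frob_centralizes; apply: centralizesM.
move=> y hy; rewrite -frob_r -mulrA; apply: h.
by apply: centralizesM => //; apply: centralizes_rmorph.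
Qed.

(** The element [\sum_l x_l # y_l] of [M #_N M] satisfies the Casimir identity
    [m x_l # y_l = x_l # y_l m], because it is the unit of the algebra [M1].
    Since [c] commutes with [N], [x # y |-> x c y] is well defined on
    [M #_N M] and transports this identity. *)
Lemma average_centralizes (R : algType k) (j : {rmorphism M -> R}) c :
  c \in centralizes (fun n => j (incl S n)) ->
  \sum_l j (dbx l) * c * j (dby (s:=S) l) \in centralizes j.
Proof.
move=> /centralizesP hc; apply/centralizesP => m.
pose f x y := j x * c * j y.
have bf : balanced (incl S) f.
  split=> [x x' y|x y y'|x n y]; rewrite /f.
  - by rewrite rmorphD !mulrDl.
  - by rewrite rmorphD mulrDr.
  - by rewrite !rmorphM -!mulrA (mulrA c) hc !mulrA.
transitivity (tlift f (1 * jones_incl S m)).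
  rewrite mulr_suml [1]/(jones_one S) /jones_one mulr_suml tlift_sum //.
  apply: eq_bigr => l _.
  by rewrite jones_incl_mulr tliftE // /f rmorphM !mulrA.
rewrite mul1r -[jones_incl S m]mulr1 [1]/(jones_one S) /jones_one.
rewrite !mulr_sumr tlift_sum //; apply: eq_bigr => l _.
by rewrite jones_incl_mull tliftE // /f rmorphM !mulrA.
Qed.

End Casimir.

(** * Non-degeneracy of the form T(a e2 e1 b) *)

Section Nondegeneracy.
Variables (k : fieldType) (N M : algType k) (S : strongly_separable N M).
Variable T : N -> k.
Hypothesis markov : symmetric_markov S T.
Local Notation lam := (lam S).
Local Notation CA := (centralizes (fun n => incl1 S (incl S n))).
Local Notation CB := (centralizes (fun m => incl2 (incl1 S m))).

Lemma trace_T0 : is_trace (T0 S T).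
Proof. exact: markov_trace_frob markov. Qed.
Lemma trace_T1 : is_trace (T1 (S:=S) T).
Proof. exact: trace_tower (markov_trace markov) trace_T0. Qed.
Lemma trace_T2 : is_trace (T2 (S:=S) T).
Proof. exact: trace_tower trace_T0 trace_T1. Qed.

Lemma T0_sum I (r : seq I) (P : pred I) F :
  T0 S T (\sum_(l <- r | P l) F l) = \sum_(l <- r | P l) T0 S T (F l).
Proof. by apply: (linear_map_sum (W:=k^o)); case: trace_T0. Qed.
Lemma T0Z c x : T0 S T (c *: x) = c * T0 S T x.
Proof. by apply: (linear_mapZ (W:=k^o)); case: trace_T0. Qed.
Lemma T1_sum I (r : seq I) (P : pred I) F :
  T1 T (\sum_(l <- r | P l) F l : M1 S) = \sum_(l <- r | P l) T1 T (F l).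
Proof. by apply: (linear_map_sum (W:=k^o)); case: trace_T1. Qed.
Lemma T2_sum I (r : seq I) (P : pred I) F :
  T2 T (\sum_(l <- r | P l) F l : M2 S) = \sum_(l <- r | P l) T2 T (F l).
Proof. by apply: (linear_map_sum (W:=k^o)); case: trace_T2. Qed.
Lemma T0C x y : T0 S T (x * y) = T0 S T (y * x).
Proof. by case: trace_T0 => _; apply. Qed.
Lemma T1C (x y : M1 S) : T1 T (x * y) = T1 T (y * x).
Proof. by case: trace_T1. Qed.
Lemma T2C (x y : M2 S) : T2 T (x * y) = T2 T (y * x).
Proof. by case: trace_T2. Qed.

Lemma T2_incl2 (x : M1 S) y : T2 T (incl2 x * y) = T1 T (x * EM1 y).
Proof. by rewrite /T2 /EM1 /incl2 frob_l. Qed.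

Lemma T1_phi u : T1 T (phi S u) = lam * \sum_l T0 S T (dbx l * u * dby (s:=S) l).
Proof.
rewrite /phi T1_sum mulr_sumr; apply: eq_bigr => l _.
by rewrite -T0Z /T1 /EM frob_r frob_jones_proj -scalerAl.
Qed.

(** By [T1_phi] the compatibility of [T0] and [T1] along [phi] is the
    identity [lam \sum_l T0 (x_l u y_l) = T0 u] for [u] in [U],
    and the trace property turns the sum into [T0 (u \sum_l y_l x_l)]. *)
Lemma symmetric_product_compatible : symmetric_product S -> T0_phi_compatible S T.
Proof.
move=> hs u; rewrite T1_phi.
transitivity (lam * T0 S T (val u * \sum_l dby (s:=S) l * dbx l)).
  by rewrite hs -scalerAr mulr1 T0Z mulrA mulfV ?lam_neq0 // mul1r.
congr (_ * _); rewrite mulr_sumr T0_sum; apply: eq_bigr => l _.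
by rewrite mulrA [LHS]T0C mulrA.
Qed.

Lemma phi_V u : u \in centralizes (incl S) -> phi S u \in centralizes (incl1 S).
Proof.
move=> hu.
have -> : phi S u = \sum_l incl (ext1 S) (dbx l) * (incl1 S u * e1 S)
                          * incl (ext1 S) (dby (s:=S) l).
  by apply: eq_bigr => l _; rewrite /incl1 rmorphM !mulrA.
apply: average_centralizes; apply: centralizesM (e1_A S).
exact: centralizes_rmorph.
Qed.

Hypothesis compat : T0_phi_compatible S T.
Hypothesis ndegU : T0_nondegenerate_on_U S T.
Hypothesis hdepth2 : depth2 S.

Lemma nondegenerate_U : nondegenerate_on (T0 S T) (centralizes (incl S)).
Proof.
move=> u hu h.
suff /(congr1 val) : Centralizer hu = 0 by [].
by apply: ndegU => u'; apply: h; apply: valP.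
Qed.

(** Each [v] in [V] is [phi u], where [u] in [U] is given by [v e1 = u e1], and
    [v phi u' = phi (u' u)]; the trace form of [V] is thereby that of [U]. *)
Lemma nondegenerate_V : nondegenerate_on (T1 (S:=S) T) (centralizes (incl1 S)).
Proof.
move=> v hv h.
pose u := lam^-1 *: EM (v * e1 S).
have ve1 : v * e1 S = incl1 S u * e1 S by rewrite /incl1 absorb_jones_proj_r.
have hu : u \in centralizes (incl S).
  apply: centralizesZ; apply: frob_centralizes.
  by apply: centralizesM (e1_A S); apply: centralizes_comp.
have v_phi u' : v * phi S u' = phi S (u' * u).
  rewrite /phi mulr_sumr; apply: eq_bigr => l _.
  rewrite !mulrA; move/centralizesP: hv => ->.
  by rewrite -(mulrA _ v) ve1 /incl1 !rmorphM !mulrA.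
(* Since phi 1 = 1, the product rule at 1 reads v = phi u. *)
suff u0 : u = 0.
  have := v_phi 1; rewrite u0 mulr0.
  rewrite [phi S 0]big1 => [|l _]; last by rewrite /incl1 mulr0 raddf0 !mul0r.
  rewrite /phi; under eq_bigr do rewrite mulr1.
  by rewrite /incl1 sum_jones_proj mulr1.
apply: nondegenerate_U => // u' hu'.
have := h _ (phi_V hu'); rewrite v_phi.
have := compat (Centralizer (centralizesM hu' hu)) => /= <-.
by rewrite T0C.
Qed.

Lemma nondegenerate_A : nondegenerate_on (T1 (S:=S) T) CA.
Proof.
case: hdepth2 => hA _.
exact: (nondegenerate_frob (S:=ext1 S) hA nondegenerate_U).
Qed.

Lemma nondegenerate_B : nondegenerate_on (T2 (S:=S) T) CB.
Proof.
case: hdepth2 => _ hB.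
exact: (nondegenerate_frob (S:=ext2 S) hB nondegenerate_V).
Qed.

(** [T2 (a e2 e1 b)] is the value of [T1] at [a E_M1 (e2 e1 b)], and
    [E_M1 (e2 e1 b)] lies in [A]. *)
Lemma form_nondegenerate_r (b : M2 S) : b \in CB ->
  (forall a, a \in CA -> T2 T (incl2 a * e2 S * incl2 (e1 S) * b) = 0) -> b = 0.
Proof.
move=> hb h; apply: e2_e1_cancel => //.
suff z0 : EM1 (e2 S * incl2 (e1 S) * b) = 0.
  rewrite -mulrA -[LHS](absorb_jones_proj_l (S:=ext1 S)).
  by rewrite -/(incl2 _) -/(EM1 _) mulrA z0 scaler0 /incl2 raddf0 mulr0.
apply: nondegenerate_A.
  apply: frob_centralizes.
  apply: centralizesM.
  2: exact: (centralizes_comp (g := fun m => incl2 (incl1 S m))).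
  apply: centralizesM.
    by apply: (centralizes_comp (g := fun m => incl2 (incl1 S m)) _ (e2_B S)).
  by apply: centralizes_rmorph; apply: e1_A.
by move=> a ha; rewrite T1C -T2_incl2 !mulrA h.
Qed.

(** The average [d = \sum_l x_l c y_l] of [c = a e2 e1] lies in [B], and
    [lam d] is the orthogonal projection of [c] on [B]: for [b] in [B] and
    [q = E_M (E_M1 (c b))] in [U], the trace of [lam d b] is
    [lam \sum_l T0 (x_l q y_l) = T0 q], the trace of [c b]. *)
Lemma form_nondegenerate_l (a : M1 S) : a \in CA ->
  (forall b, b \in CB -> T2 T (incl2 a * e2 S * incl2 (e1 S) * b) = 0) -> a = 0.
Proof.
move=> ha h.
set c := incl2 a * e2 S * incl2 (e1 S) in h *.
have hc : c \in centralizes (fun n => incl2 (incl1 S (incl S n))).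
  apply: centralizesM; last by apply: centralizes_rmorph; apply: e1_A.
  apply: centralizesM; first exact: centralizes_rmorph.
  exact: (centralizes_comp (g := fun m => incl2 (incl1 S m)) _ (e2_B S)).
pose j12 : {rmorphism M -> M2 S} := incl (ext2 S) \o incl (ext1 S).
pose d := \sum_l j12 (dbx l) * c * j12 (dby (s:=S) l).
have hd : d \in CB by apply: average_centralizes.
have d0 : d = 0.
  apply: nondegenerate_B => // b hb.
  pose q := EM (EM1 (c * b)).
  have hq : q \in centralizes (incl S).
    apply: frob_centralizes; apply: frob_centralizes.
    apply: centralizesM => //.
    exact: (centralizes_comp (g := fun m => incl2 (incl1 S m))).
  apply: (mulfI (lam_neq0 S)); rewrite mulr0 -[RHS](h b hb).
  transitivity (T0 S T q); last by [].
  have := compat (Centralizer hq) => /= ->.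
  rewrite T1_phi /d mulr_suml T2_sum; congr (_ * _); apply: eq_bigr => l _.
  rewrite -mulrA; move/centralizesP: hb => hb.
  rewrite -[j12 (dby l) * b]hb mulrA -(mulrA _ c) /q /EM /EM1.
  by rewrite -(frob_bimod (ext1 S)) -(frob_bimod (ext2 S)).
(* d e1 = c: e1 y_l e1 = E(y_l) e1 and c commutes with E(y_l), so the sum
   collapses to \sum_l x_l E(y_l) = 1. *)
have c0 : c = 0.
  rewrite -[LHS]mul1r -(rmorph1 j12) -(sum_dual_basis_frob S) rmorph_sum mulr_suml.
  rewrite -[RHS](mul0r (incl2 (e1 S))) -[in RHS]d0 mulr_suml; apply: eq_bigr => l _.
  rewrite rmorphM -mulrA; move/centralizesP: hc => hc.
  rewrite -[j12 (incl S _) * c]hc -!mulrA; do 3!congr (_ * _).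
  rewrite -[j12 _]/(incl2 (incl1 S _)) -!rmorphM mulrA /e1 /incl1 jones_proj_frob.
  by rewrite jones_proj_comm.
(* 0 = c e2 = a e2 e1 e2 = lam a e2. *)
apply: (jones_proj_inj (S:=ext1 S)).
apply: (scalerI (lam_neq0 S)).
rewrite raddf0 mul0r scaler0 scalerAr -e2_e1_e2.
by rewrite -/(incl2 _) !mulrA -/c c0 mul0r.
Qed.

End Nondegeneracy.

(** * The action of B on M1 *)

Section Action.
Variables (k : fieldType) (N M : algType k) (S : strongly_separable N M).
Local Notation CA := (centralizes (fun n => incl1 S (incl S n))).
Implicit Types (b : algB S) (x y : M1 S).

Lemma jones_act_e2 b x : incl2 (jones_act b x) * e2 S = val b * incl2 x * e2 S.
Proof. exact: (absorb_jones_proj_r (S:=ext1 S)). Qed.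

(** The working criterion for computing the action: find [y] in [M1] with
    [y e2 = b x e2]. *)
Lemma jones_actP b x y :
  incl2 y * e2 S = val b * incl2 x * e2 S -> jones_act b x = y.
Proof.
move=> h; apply: (jones_proj_inj (S:=ext1 S)).
by rewrite -/(incl2 _) -/(incl2 _) h -jones_act_e2.
Qed.

Lemma jones_act_bilin : bilin (@jones_act k N M S).
Proof.
split=> [x c b b'|b c x y]; apply: jones_actP.
  by rewrite /incl2 !linearP /= !mulrDl -!scalerAl -!/(incl2 _) !jones_act_e2.
rewrite /incl2 !linearP /= mulrDr !mulrDl -!scalerAr -!scalerAl -!/(incl2 _).
by rewrite !jones_act_e2.
Qed.

Lemma jones_act1 x : jones_act 1 x = x.
Proof. by apply: jones_actP; rewrite mul1r. Qed.

Lemma jones_actM b b' x : jones_act (b * b') x = jones_act b (jones_act b' x).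
Proof. by apply: jones_actP; rewrite jones_act_e2 -mulrA jones_act_e2 !mulrA. Qed.

Lemma jones_act_incl1_l b m x :
  jones_act b (incl1 S m * x) = incl1 S m * jones_act b x.
Proof.
apply: jones_actP; rewrite !incl2M -mulrA jones_act_e2 !mulrA.
by have /centralizesP <- := valP b.
Qed.

Lemma jones_act_incl1_r b x m :
  jones_act b (x * incl1 S m) = jones_act b x * incl1 S m.
Proof.
apply: jones_actP; rewrite !incl2M -!mulrA incl2_e2.
by rewrite !mulrA jones_act_e2.
Qed.

Lemma jones_act_A b x : x \in CA -> jones_act b x \in CA.
Proof.
move=> /centralizesP hx; apply/centralizesP => n.
by rewrite -jones_act_incl1_r hx jones_act_incl1_l.
Qed.

Definition actA b (a : algA S) : algA S := Centralizer (jones_act_A b (valP a)).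

Lemma jones_act_unit b : jones_act b 1 \in centralizes (incl1 S).
Proof.
apply/centralizesP => m.
by rewrite -jones_act_incl1_r -jones_act_incl1_l mul1r mulr1.
Qed.

Lemma jones_act_proj x : jones_act (Centralizer (e2_B S)) x = incl1 S (EM x).
Proof. by apply: jones_actP; rewrite /= /e2 /incl2 jones_proj_frob. Qed.

(** [M1 = M A]: dual bases of [M1] over [M] that lie in [A] span [M1] over
    [M]. *)
Lemma M1_ind (Q : M1 S -> Prop) :
  has_dual_bases_in (ext1 S) CA ->
  Q 0 -> (forall x y, Q x -> Q y -> Q (x + y)) ->
  (forall m (a : algA S), Q (incl1 S m * val a)) -> forall x, Q x.
Proof.
move=> [r [u [v [uv hl _]]]] Q0 QD Qa x; rewrite -(hl x).
apply: (big_ind Q) => // l _; have [_ hv] := uv l.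
exact: (Qa _ (Centralizer hv)).
Qed.

End Action.

(** * The module algebra structure and its invariants *)

Section Pairing.
Variables (k : fieldType) (N M : algType k) (S : strongly_separable N M).
Variable T : N -> k.
Hypothesis markov : symmetric_markov S T.
Variables (w : algV S).
Implicit Types (a : algA S) (b : algB S).

Lemma pairing_linear_l b : scalar (fun a => pairing T w a b).
Proof.
move=> c a a'; rewrite /pairing.
have [T2l _] := trace_T2 markov.
rewrite /incl2 linearP /= !mulrDl -!scalerAl T2l mulrDr.
by rewrite mulrCA.
Qed.

Lemma pairing_linear_r a : scalar (pairing T w a).
Proof.
move=> c b b'; rewrite /pairing.
have [T2l _] := trace_T2 markov.
by rewrite linearP /= mulrDr -scalerAr T2l mulrDr mulrCA.
Qed.

(** The action on [A] is the transpose of right multiplication: replace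
    [(b |> a) e2] by [b a e2] and move [b] to the end by the trace property. *)
Lemma pairing_actA a b b' : pairing T w (actA b a) b' = pairing T w a (b' * b).
Proof.
congr (_ * _); rewrite /= jones_act_e2 -!mulrA (T2C markov).
by rewrite !mulrA.
Qed.

Variable f : seq (algV S * algV S).
Hypothesis hw : is_weight T f w.
Hypothesis compat : T0_phi_compatible S T.
Hypothesis ndegU : T0_nondegenerate_on_U S T.
Hypothesis hdepth2 : depth2 S.

Lemma V_sub_B (v : algV S) :
  incl2 (val v) \in centralizes (fun m => incl2 (incl1 S m)).
Proof. exact: centralizes_rmorph (valP v). Qed.

Lemma lam2_neq0 : (lam S)^-2 != 0.
Proof. by rewrite invr_eq0 expf_neq0 ?lam_neq0. Qed.

(** [w] is invertible and [V] lies in [B], so [b |-> w b] is a bijection of [B]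
    and the factor [w] does not affect the radicals of the form. *)
Lemma pairing_nondegenerate_l a : (forall b, pairing T w a b = 0) -> a = 0.
Proof.
move=> h; have [ws _] := hw; set s := tsum _ _ in ws.
apply: val_inj; apply: (form_nondegenerate_l markov compat ndegU hdepth2).
  exact: valP.
move=> b hb.
have := h (Centralizer (centralizesM (V_sub_B s) hb)).
rewrite /pairing /= => /eqP; rewrite mulf_eq0 (negPf lam2_neq0) => /eqP /=.
rewrite -[_ * incl2 (val w) * _]mulrA [incl2 (val w) * _]mulrA -incl2M.
have -> : val w * val s = 1 by have := congr1 val ws.
by rewrite incl2_1 mul1r.
Qed.

Lemma pairing_nondegenerate_r b : (forall a, pairing T w a b = 0) -> b = 0.
Proof.
move=> h; have [_ sw] := hw; set s := tsum _ _ in sw.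
have wb0 : incl2 (val w) * val b = 0.
  apply: (form_nondegenerate_r markov ndegU hdepth2) => [|a ha].
    by apply: centralizesM (V_sub_B w) (valP b).
  have /eqP := h (Centralizer ha).
  by rewrite /pairing mulf_eq0 (negPf lam2_neq0) mulrA => /eqP.
apply: val_inj; rewrite /= -[LHS]mul1r -incl2_1.
have <- : val s * val w = 1 by have := congr1 val sw.
by rewrite incl2M -mulrA wb0 mulr0.
Qed.

Lemma pairing_inj_l a a' : (forall b, pairing T w a b = pairing T w a' b) -> a = a'.
Proof.
move=> h; apply/eqP; rewrite -subr_eq0; apply/eqP.
apply: pairing_nondegenerate_l => b.
by rewrite (linear_mapB (W:=k^o) (pairing_linear_l b)) h subrr.
Qed.

Lemma pairing_inj_r b b' : (forall a, pairing T w a b = pairing T w a b') -> b = b'.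
Proof.
move=> h; apply/eqP; rewrite -subr_eq0; apply/eqP.
apply: pairing_nondegenerate_r => a.
by rewrite (linear_mapB (W:=k^o) (pairing_linear_r a)) h subrr.
Qed.

Lemma M1_ind_A (Q : M1 S -> Prop) :
  Q 0 -> (forall x y, Q x -> Q y -> Q (x + y)) ->
  (forall m a, Q (incl1 S m * val a)) -> forall x, Q x.
Proof. by apply: M1_ind; case: hdepth2. Qed.

Variable B : weak_hopf (algB S).
Hypothesis hcomul : forall b a1 a2,
  tsum (fun b1 b2 => pairing T w a1 b1 * pairing T w a2 b2) (comul B b)
  = pairing T w (a1 * a2) b.
Hypothesis hcounit : forall b, counit B b = pairing T w 1 b.

(** Paired with [b'], both sides become the value of [<a, _> <a', _>] on the
    comultiplication of [b' b]. *)
Lemma actA_mul b a a' :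
  actA b (a * a') = tsum (fun b1 b2 => actA b1 a * actA b2 a') (comul B b).
Proof.
apply: pairing_inj_l => b'.
rewrite pairing_actA -hcomul (comulM B b' b (P := k^o)); last first.
  split=> [y c x x'|x c y y'].
    by rewrite (pairing_linear_r a) mulrDl -mulrA.
  by rewrite (pairing_linear_r a') mulrDr mulrCA.
rewrite [RHS](linear_map_sum (W := k^o) (pairing_linear_l b')) /tsum.
rewrite exchange_big; apply: eq_bigr => -[b1 b2] _ /=.
rewrite -hcomul; apply: eq_bigr => p _.
by rewrite !pairing_actA.
Qed.

(** From [A] the product rule extends to [M1 A] by left [M]-linearity in [x],
    and then to [M1 M A] because [x m] may take the place of [x] and
    [(b1 |> x m) (b2 |> a) = (b1 |> x) (b2 |> m a)]. *)
Lemma jones_act_mul b x y :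
  jones_act b (x * y)
  = tsum (fun b1 b2 => jones_act b1 x * jones_act b2 y) (comul B b).
Proof.
have [_ lact] := jones_act_bilin S.
have xA x' a : jones_act b (x' * val a)
    = tsum (fun b1 b2 => jones_act b1 x' * jones_act b2 (val a)) (comul B b).
  elim/M1_ind_A: x' => [|x' x'' hx' hx''|m a'].
  - rewrite mul0r (linear_map0 (lact b)) /tsum big1 // => p _.
    by rewrite (linear_map0 (lact p.1)) mul0r.
  - rewrite mulrDl (linear_mapD (lact b)) hx' hx'' -big_split.
    apply: eq_bigr => p _ /=.
    by rewrite (linear_mapD (lact p.1)) mulrDl.
  rewrite -mulrA jones_act_incl1_l.
  have := congr1 val (actA_mul b a' a); rewrite /= => ->.
  rewrite /tsum cval_sum mulr_sumr; apply: eq_bigr => p _ /=.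
  by rewrite jones_act_incl1_l mulrA.
elim/M1_ind_A: y => [|y y' hy hy'|m a].
- rewrite mulr0 (linear_map0 (lact b)) /tsum big1 // => p _.
  by rewrite (linear_map0 (lact p.2)) mulr0.
- rewrite mulrDr (linear_mapD (lact b)) hy hy' -big_split; apply: eq_bigr => p _ /=.
  by rewrite (linear_mapD (lact p.2)) mulrDr.
rewrite mulrA xA; apply: eq_bigr => p _.
by rewrite jones_act_incl1_r jones_act_incl1_l mulrA.
Qed.

(** [b |> 1], which lies in [V], regarded as an element of [B]. *)
Definition unit_orbit b : algB S :=
  Centralizer (V_sub_B (Centralizer (jones_act_unit b))).

(** Pairing [eps_t b] with [a] gives [<1, 1_(1) b> <a, 1_(2)>], that is,
    [<b |> 1, 1_(1)> <a, 1_(2)> = <(b |> 1) a, 1>]; as [T2] is a trace, the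
    factor [b |> 1] of [V] can be moved from the left of [a] to the slot of
    [B]. *)
Lemma target_counitE b : target_counit B b = unit_orbit b.
Proof.
apply: pairing_inj_r => a.
rewrite /target_counit (linear_map_sum (W := k^o) (pairing_linear_r a)).
transitivity (pairing T w (actA b 1 * a) 1).
  rewrite -hcomul; apply: eq_bigr => p _.
  rewrite (linear_mapZ (W := k^o) (pairing_linear_r a)) hcounit.
  by rewrite pairing_actA.
congr (_ * _); rewrite /= mulr1 incl2M -!mulrA (T2C markov).
by rewrite !mulrA.
Qed.

Lemma jones_act_one b : jones_act b 1 = jones_act (target_counit B b) 1.
Proof.
rewrite target_counitE; apply: esym; apply: jones_actP.
by rewrite incl2_1 mulr1.
Qed.

Lemma jones_module_algebra : module_algebra B (@jones_act k N M S).
Proof.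
split; [exact: jones_act_bilin | exact: jones_act1 | exact: jones_actM
       | exact: jones_act_mul | exact: jones_act_one].
Qed.

(** [e2] lies in [B] and acts as the conditional expectation [E_M], while
    [eps_t e2 = e2 |> 1 = 1]; an invariant element is therefore fixed by
    [E_M]. *)
Lemma jones_act_invariantP x :
  act_invariant B (@jones_act k N M S) x <-> exists m, x = incl1 S m.
Proof.
split=> [h | [m ->] b].
  exists (EM x); rewrite -jones_act_proj h target_counitE.
  suff -> : unit_orbit (Centralizer (e2_B S)) = 1 by rewrite jones_act1.
  apply: val_inj; rewrite /= jones_act_proj.
  by rewrite [EM 1]frob1 [incl1 S 1]rmorph1 incl2_1.
by rewrite -[incl1 S m]mulr1 !jones_act_incl1_l jones_act_one.
Qed.

Variable comulA : algA S -> seq (algA S * algA S).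
Hypothesis hcomulA : forall a b b',
  tsum (fun a1 a2 => pairing T w a1 b * pairing T w a2 b') (comulA a)
  = pairing T w a (b * b').

Lemma actA_comulA b a :
  actA b a = tsum (fun a1 a2 => pairing T w a2 b *: a1) (comulA a).
Proof.
apply: pairing_inj_l => b'; rewrite pairing_actA -hcomulA.
rewrite [RHS](linear_map_sum (W := k^o) (pairing_linear_l b')).
apply: eq_bigr => p _.
by rewrite (linear_mapZ (W := k^o) (pairing_linear_l b')) mulrC.
Qed.

Lemma jones_act_formula m a b :
  jones_act b (incl1 S m * val a)
  = incl1 S m * tsum (fun a1 a2 => pairing T w a2 b *: val a1) (comulA a).
Proof.
rewrite jones_act_incl1_l; congr (_ * _).
have := congr1 val (actA_comulA b a); rewrite /= => ->.
by rewrite /tsum cval_sum; apply: eq_bigr.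
Qed.

End Pairing.

Theorem proposition4p1 (k : fieldType) (N M : algType k)
    (S : strongly_separable N M) (T : N -> k)
    (markov : symmetric_markov S T)
    (symprod : symmetric_product S \/ T0_phi_compatible S T)
    (sepU : kanzaki_separable (algU S))
    (ndegU : T0_nondegenerate_on_U S T)
    (hdepth2 : depth2 S)
    (f : seq (algV S * algV S)) (hf : symmetric_separability_element f)
    (w : algV S) (hw : is_weight T f w)
    (B : weak_hopf (algB S))
    (hcomul : forall (b : algB S) (a1 a2 : algA S),
       tsum (fun b1 b2 => pairing T w a1 b1 * pairing T w a2 b2) (comul B b)
       = pairing T w (a1 * a2) b)
    (hcounit : forall b : algB S, counit B b = pairing T w 1 b)
    (hantipode : forall (a : algA S) (b : algB S),
       pairing T w a b = pairing' T w a (antipode B b))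
    (comulA : algA S -> seq (algA S * algA S))
    (hcomulA : forall (a : algA S) (b b' : algB S),
       tsum (fun a1 a2 => pairing T w a1 b * pairing T w a2 b') (comulA a)
       = pairing T w a (b * b')) :
  let act_formula (act : algB S -> M1 S -> M1 S) :=
    forall (m : M) (a : algA S) (b : algB S),
      act b (incl1 S m * \val a)
      = incl1 S m * tsum (fun a1 a2 => pairing T w a2 b *: \val a1) (comulA a) in
  [/\ module_algebra B (@jones_act k N M S),
      act_formula (@jones_act k N M S)
        /\ (forall act : algB S -> M1 S -> M1 S, bilin act ->
              act_formula act -> forall b x, act b x = jones_act b x)
    & forall x : M1 S,
        act_invariant B (@jones_act k N M S) x <-> exists m : M, x = incl1 S m].
Proof.
have compat : T0_phi_compatible S T.
  by case: symprod => // h; apply: symmetric_product_compatible.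
have formula := jones_act_formula markov hw compat ndegU hdepth2 hcomulA.
split.
- exact: (jones_module_algebra markov hw compat ndegU hdepth2 hcomul hcounit).
- split=> // act [_ lact] hact b x.
  have [_ ljones] := jones_act_bilin S.
  elim/(M1_ind_A hdepth2): x => [|x y hx hy|m a].
  + by rewrite (linear_map0 (lact b)) (linear_map0 (ljones b)).
  + by rewrite (linear_mapD (lact b)) (linear_mapD (ljones b)) hx hy.
  by rewrite hact formula.
exact: (jones_act_invariantP markov hw ndegU hdepth2 hcomul hcounit).
Qed.
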